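(* Let $\tau\subset\mathbb{Z}^4_{\ge 0}$ be a B-facet. Then $\tau$ is of (at least) one of the following four types: (1) a $B_1$-facet: there is an index $i\in\{1,2,3,4\}$ such that exactly one point of $\tau$ has nonzero $i$-th coordinate, and that coordinate equals $1$; (2) a $B_2$-facet: there are distinct indices $i,j$ such that for every point $x\in\tau$ we have $(x_i,x_j)\in\{(0,0),(1,0),(0,1)\}$; (3) a flat border: there are distinct indices $i,j$ and a point $C\in\tau$ with $C_i=C_j=1$ such that $\tau$ contains at least two distinct points $A,B$ with $A_i=A_j=B_i=B_j=0$, and every point of $\tau$ other than $C$ lies in $\{x_i=0\}\cup\{x_j=0\}$; (4) the standard cross-polytope: $\tau=\{(1,1,0,0),(1,0,1,0),(1,0,0,1),(0,1,1,0),(0,1,0,1),(0,0,1,1)\}$.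
   Context: Conventions: a polytope is a finite subset of $\mathbb{Z}^n$; its dimension is the dimension of its affine span. A $k$-simplex is a set of $k+1$ affinely independent points. A $k$-simplex $S\subset\mathbb{Z}^n_{\ge0}$ is a B-simplex if there is a coordinate index $i$ such that exactly $k$ of its vertices lie in the hyperplane $\{x_i=0\}$ and the remaining vertex has $i$-th coordinate equal to $1$ (i.e. it is a pyramid of height $1$ with base on a coordinate hyperplane; for $k=0$ this means the point has some coordinate equal to $1$). A B-facet in $\mathbb{Z}^n_{\ge0}$ is a finite set $\tau\subset\mathbb{Z}^n_{\ge 0}$ whose affine span is a hyperplane $\{x:\langle a,x\rangle=b\}$ with all $a_j>0$ (positive normal covector), such that every $(n-1)$-simplex with vertices in $\tau$ is a B-simplex. *)

(* Defs.v *)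
From HB Require Import structures.
From mathcomp Require Import all_boot all_order all_algebra.
From mathcomp Require Import finmap.
Set Implicit Arguments. Unset Strict Implicit. Unset Printing Implicit Defensive.
Import Order.TTheory GRing.Theory Num.Theory.
Local Open Scope ring_scope.
Local Open Scope fset_scope.

Definition pt4 := {ffun 'I_4 -> nat}.

Definition mkpt (a b c d : nat) : pt4 :=
  [ffun i : 'I_4 => nth 0%N [:: a; b; c; d] i].

Definition in_aff_span (S : {fset pt4}) (x : 'I_4 -> rat) : Prop :=
  exists lam : pt4 -> rat,
    \sum_(p <- S) lam p = 1 /\
    forall j : 'I_4, x j = \sum_(p <- S) lam p * (p j)%:R.

Definition aff_indep (S : {fset pt4}) : Prop :=
  forall lam : pt4 -> rat,
    \sum_(p <- S) lam p = 0 ->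
    (forall j : 'I_4, \sum_(p <- S) lam p * (p j)%:R = 0) ->
    forall p, p \in S -> lam p = 0.

Definition is_simplex (k : nat) (S : {fset pt4}) : Prop :=
  #|` S| = k.+1 /\ aff_indep S.

Definition B_simplex (k : nat) (S : {fset pt4}) : Prop :=
  is_simplex k S /\
  exists i : 'I_4,
    #|` [fset p in S | p i == 0%N]| = k /\
    forall p, p \in S -> p i != 0%N -> p i = 1%N.

Definition B_facet (tau : {fset pt4}) : Prop :=
  (exists (a : 'I_4 -> rat) (b : rat),
      (forall j, 0 < a j) /\
      forall x : 'I_4 -> rat,
        in_aff_span tau x <-> \sum_(j < 4) a j * x j = b) /\
  (forall S : {fset pt4}, S `<=` tau -> is_simplex 3 S -> B_simplex 3 S).

Definition B1_facet (tau : {fset pt4}) : Prop :=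
  exists i : 'I_4,
    #|` [fset p in tau | p i != 0%N]| = 1%N /\
    forall p, p \in tau -> p i != 0%N -> p i = 1%N.

Definition B2_facet (tau : {fset pt4}) : Prop :=
  exists i j : 'I_4, i != j /\
    forall x, x \in tau ->
      (x i, x j) \in [:: (0, 0); (1, 0); (0, 1)]%N.

Definition flat_border (tau : {fset pt4}) : Prop :=
  exists (i j : 'I_4) (C : pt4),
    [/\ i != j, C \in tau, C i = 1%N & C j = 1%N] /\
        (exists A B : pt4, [/\ A \in tau, B \in tau, A != B &
            [/\ A i = 0%N, A j = 0%N, B i = 0%N & B j = 0%N]]) /\
        (forall x, x \in tau -> x != C -> x i = 0%N \/ x j = 0%N).

Definition cross_polytope : {fset pt4} :=
  [fset mkpt 1 1 0 0; mkpt 1 0 1 0; mkpt 1 0 0 1;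
        mkpt 0 1 1 0; mkpt 0 1 0 1; mkpt 0 0 1 1]%N.

(* Main.v *)
(** The affine span of a B-facet [tau] is a hyperplane with positive normal, so
    [tau] is an antichain, and every affinely independent subset of [tau] extends
    to a 3-simplex, which is a B-simplex: some coordinate sums to 1 over its
    vertices. Hence a subset of [tau] over which every coordinate sums to at
    least 2, called dead below, is affinely dependent.

    Deadness depends only on the classes of the points, i.e. on their
    coordinates truncated at 2, and independence of at most four points can often
    be certified from the classes alone: an affine form that is nonnegative on the
    points with positive coefficient, nonpositive on those with negative
    coefficient and nonzero on one of them excludes that sign pattern for an
    affine relation. If [tau] were of none of the four types, then the failure of
    each type, and the extension of independent triples, would keep providing new
    points of [tau]; a finite branching search over the classes of these points,
    up to permutation of the coordinates, always ends in a contradiction. *)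
Require Import Defs.
From Stdlib Require Import Classical_Prop.
From mathcomp Require Import all_boot all_order all_algebra all_fingroup.
From mathcomp Require Import finmap.
From mathcomp Require Import ring zify.
Set Implicit Arguments. Unset Strict Implicit. Unset Printing Implicit Defensive.
Import Order.TTheory GRing.Theory Num.Theory.
Local Open Scope fset_scope.
Local Open Scope nat_scope.

(** * Affine independence and extension to B-simplices *)

Definition aff_free (l : seq pt4) := forall lam : pt4 -> rat,
  (\sum_(p <- l) lam p = 0)%R ->
  (forall j : 'I_4, \sum_(p <- l) lam p * (p j)%:R = 0)%R ->
  forall p, p \in l -> (lam p = 0)%R.

Definition vec (p : pt4) : 'rV[rat]_4 := (\row_j (p j)%:R)%R.

Lemma sum_vecE (l : seq pt4) (lam : pt4 -> rat) (j : 'I_4) :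
  ((\sum_(p <- l) lam p *: vec p) 0 j = \sum_(p <- l) lam p * (p j)%:R)%R.
Proof. by rewrite summxE; apply: eq_bigr => p _; rewrite !mxE. Qed.

Lemma free_aff_free l : uniq l -> free (map vec l) -> aff_free l.
Proof.
move=> ul /(@freeP _ _ _ (in_tuple _)) fr lam _ lam0 p pl.
have ip : index p l < size (map vec l) by rewrite size_map index_mem.
have := fr (fun i => lam (nth p l i)) _ (Ordinal ip); rewrite /= nth_index //; apply.
transitivity (\sum_(p <- l) lam p *: vec p)%R; last first.
  by apply/rowP => j; rewrite sum_vecE lam0 mxE.
rewrite (big_nth p) big_mkord size_map; apply: eq_bigr => i _.
by rewrite (nth_map p).
Qed.

(** On a hyperplane missing the origin, pairing a linear relation with [a] forces its coefficients
    to sum to zero, so every linear relation is affine. *)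
Lemma aff_free_free (a : 'I_4 -> rat) (b : rat) (l : seq pt4) :
  (b != 0)%R -> (forall p, p \in l -> \sum_j a j * (p j)%:R = b)%R ->
  uniq l -> aff_free l -> free (map vec l).
Proof.
move=> b0 al ul fl; suff: free (in_tuple (map vec l)) by [].
apply/freeP => k k0 i; pose p0 : pt4 := [ffun => 0].
have sz (m : 'I_(size (map vec l))) : m < size l by rewrite -(size_map vec l).
pose lam p := (\sum_(i : 'I_(size (map vec l)) | nth p0 l i == p) k i)%R.
have lamE (m : 'I_(size (map vec l))) : lam (nth p0 l m) = k m.
  by rewrite /lam (big_pred1 m) // => j; rewrite /= nth_uniq.
have lam0 : (\sum_(p <- l) lam p *: vec p = 0)%R.
  rewrite -[RHS]k0 (big_nth p0) big_mkord -(size_map vec); apply: eq_bigr => j _.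
  by rewrite lamE (nth_map p0).
have lamj j : (\sum_(p <- l) lam p * (p j)%:R = 0)%R by rewrite -sum_vecE lam0 mxE.
rewrite -lamE; apply: fl => //; last exact: mem_nth.
apply/eqP; rewrite -[_ == _]orFb -(negPf b0) -mulf_eq0; apply/eqP.
rewrite mulr_sumr big_seq.
rewrite (eq_bigr (fun p => \sum_j a j * (lam p * (p j)%:R))%R); last first.
  by move=> p pl; rewrite -(al p pl) mulr_suml; apply: eq_bigr => j _; ring.
rewrite -big_seq exchange_big big1 // => j _.
by rewrite -mulr_sumr lamj mulr0.
Qed.

Lemma free_extension (l t : seq pt4) : free (map vec l) ->
  exists m, [/\ {subset m <= t}, free (map vec (m ++ l)) &
    (forall p, p \in t -> vec p \in <<map vec (m ++ l)>>%VS)].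
Proof.
move=> fl; elim: t => [|p t [m [mt fm spm]]]; first by exists [::].
have [pm|pm] := boolP (vec p \in <<map vec (m ++ l)>>%VS).
  exists m; split => // q; first by move/mt; rewrite inE orbC => ->.
  by rewrite inE => /predU1P[-> //|/spm].
exists (p :: m); split; rewrite /=.
- by move=> q; rewrite !inE => /predU1P[->|/mt ->]; rewrite ?eqxx ?orbT.
- by rewrite free_cons pm.
- move=> q; rewrite inE span_cons => /predU1P[->|/spm qm].
    by rewrite memvE addvSl.
  by apply: (subvP _ _ qm); rewrite addvSr.
Qed.

Lemma B_facet_normal (tau : {fset pt4}) : B_facet tau ->
  exists (a : 'I_4 -> rat) (b : rat),
    [/\ (forall j, 0 < a j)%R, (b != 0)%R,
        (forall p, p \in tau -> \sum_j a j * (p j)%:R = b)%R &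
        (fullv <= <<map vec tau>>)%VS].
Proof.
case=> -[a [b [a0 H]]] _; exists a, b.
have taub p : p \in tau -> (\sum_j a j * (p j)%:R = b)%R.
  move=> pt; apply/H; exists (fun q => (q == p)%:R)%R; split => [|j];
    rewrite (bigD1_seq p) ?fset_uniq //= eqxx ?mul1r big1 ?addr0 // => q /negPf ->;
    by rewrite ?mul0r.
have b0 : (b != 0)%R.
  apply/eqP => b0.
  have tau0 p j : p \in tau -> p j = 0.
    move=> pt; apply/eqP; rewrite -(pnatr_eq0 rat).
    have /eqP := taub p pt; rewrite b0 psumr_eq0; last first.
      by move=> i _; rewrite mulr_ge0 ?ler0n // ltW.
    move=> /allP/(_ j (mem_index_enum _)); rewrite /= mulf_eq0.
    by rewrite (gt_eqF (a0 j)).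
  (* With [b = 0] this nonzero point lies on the hyperplane, whereas the affine span of [tau] would
     reduce to the origin. *)
  pose x (j : 'I_4) : rat := nth 0%R [:: a (@Ordinal 4 1 isT); - a ord0; 0; 0]%R j.
  have /H[lam [_ /(_ ord0)]] : (\sum_(j < 4) a j * x j = b)%R.
    rewrite b0 !big_ord_recl big_ord0 /x /=.
    have -> : lift ord0 ord0 = @Ordinal 4 1 isT by exact: val_inj.
    by ring.
  rewrite big_seq big1 => [|p /tau0 ->]; last by rewrite mulr0.
  by move=> /esym/eqP; rewrite eq_sym /x /= gt_eqF.
split=> //; apply/subvP => u _; rewrite [u]row_sum_delta.
apply: memv_suml => j _; apply: memvZ.
(* The hyperplane meets the [j]-th axis in a point of the affine span, so the [j]-th basis vector
   lies in the linear span. *)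
have /H[lam [_ lamE]] : (\sum_i a i * ((i == j)%:R * (b / a j)) = b)%R.
  rewrite (bigD1 j) //= eqxx big1 => [|i /negPf->]; last by rewrite mul0r mulr0.
  by rewrite addr0 mul1r mulrC divfK // gt_eqF.
have -> : (delta_mx 0 j = (a j / b) *: (\sum_(p <- tau) lam p *: vec p))%R.
  apply/rowP => i; rewrite mxE [RHS]mxE sum_vecE -lamE eqxx /= eq_sym.
  case: eqP => [->|_]; last by rewrite mul0r mulr0.
  by rewrite mul1r mulrA divfK // divff // gt_eqF.
apply: memvZ; rewrite big_seq; apply: memv_suml => p pt; apply: memvZ.
by apply: memv_span; apply: map_f.
Qed.

Lemma B_facet_antichain (tau : {fset pt4}) p q : B_facet tau ->
  p \in tau -> q \in tau -> (forall j, p j <= q j) -> p = q.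
Proof.
move=> /B_facet_normal[a [b [a0 _ taub _]]] pt qt pq; apply/ffunP => j; apply/eqP.
have: (\sum_i a i * ((q i)%:R - (p i)%:R) = 0)%R.
  under eq_bigr do rewrite mulrBr.
  by rewrite sumrB !taub // subrr.
move/eqP; rewrite psumr_eq0 => [|i _]; last first.
  by rewrite mulr_ge0 ?subr_ge0 ?ler_nat // ltW.
move=> /allP/(_ j (mem_index_enum _)); rewrite /= mulf_eq0 (gt_eqF (a0 j)) /=.
by rewrite subr_eq0 eqr_nat eq_sym.
Qed.

Lemma B_simplex_sum k (S : {fset pt4}) : B_simplex k S ->
  exists i : 'I_4, sumn [seq p i | p : pt4 <- S] = 1.
Proof.
case=> -[Sk _] [i [S0 S1]]; exists i.
have zS : count (fun p : pt4 => p i == 0) S = k.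
  rewrite -[RHS]S0 -size_filter; apply: perm_size; apply: uniq_perm.
  - by rewrite filter_uniq ?fset_uniq.
  - exact: fset_uniq.
  - by move=> p; rewrite mem_filter !inE andbC.
have -> : sumn [seq p i | p : pt4 <- S] = count (predC (fun p : pt4 => p i == 0)) S.
  rewrite -sumn_count; congr sumn; apply/eq_in_map => p pS /=.
  by case: eqP => [->|/eqP /(S1 _ pS) ->].
by have := count_predC (fun p : pt4 => p i == 0) S; rewrite zS Sk; lia.
Qed.

(** A maximal free extension inside [tau] spans the 4-dimensional space, so it has four points and
    is a 3-simplex. *)
Lemma B_facet_extension (tau : {fset pt4}) (l : seq pt4) : B_facet tau ->
  uniq l -> {subset l <= tau} -> aff_free l ->
  exists (m : seq pt4) (i : 'I_4), [/\ {subset m <= tau}, uniq (m ++ l),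
    size (m ++ l) = 4 & sumn [seq p i | p : pt4 <- m ++ l] = 1].
Proof.
move=> Bt ul lt fl; have [a [b [_ b0 taub spt]]] := B_facet_normal Bt.
have /(@free_extension _ tau)[m [mt fm spm]] : free (map vec l).
  by apply: (aff_free_free b0 _ ul fl) => p /lt; apply: taub.
have um : uniq (m ++ l) by apply: (@map_uniq _ _ vec); apply: free_uniq.
have sm : size (m ++ l) = 4.
  rewrite -(size_map vec); move: fm; rewrite /free => /eqP <-.
  suff -> : <<map vec (m ++ l)>>%VS = fullv by rewrite dimvf.
  apply/eqP; rewrite eqEsubv subvf (subv_trans spt) //.
  by apply/span_subvP => u /mapP[p pt ->]; apply: (spm p pt).
pose S := [fset p in m ++ l].
have pS : perm_eq S (m ++ l).
  by apply: uniq_perm => // p; rewrite in_fset.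
have [i Si] : exists i : 'I_4, sumn [seq p i | p : pt4 <- S] = 1.
  apply: (@B_simplex_sum 3); apply: Bt.2.
    by apply/fsubsetP => p; rewrite in_fset mem_cat => /orP[/mt|/lt].
  split; first by rewrite (perm_size pS) sm.
  move=> lam l0 lj p; rewrite (perm_mem pS).
  by apply: (free_aff_free um fm); rewrite -?(perm_big _ pS) // => j; rewrite -(perm_big _ pS).
exists m, i; split => //; apply: etrans Si; apply: perm_sumn.
by rewrite perm_sym; apply: perm_map.
Qed.

Lemma B_facet_coord_neq0 (tau : {fset pt4}) (i : 'I_4) : B_facet tau ->
  exists2 p, p \in tau & p i != 0.
Proof.
case/B_facet_normal=> [a [b [_ _ _ spt]]]; apply/hasP.
apply/negPn/negP => /hasPn tau0.
have := subvP spt (delta_mx 0 i)%R (memvf _).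
move/(@coord_span _ _ _ (in_tuple _))/rowP/(_ i)/eqP.
rewrite mxE !eqxx summxE big1 ?oner_eq0 // => j _; rewrite mxE.
have /mapP[p pt ->] := mem_nth 0%R (ltn_ord j); rewrite mxE.
by have /negPn/eqP -> := tau0 p pt; rewrite mulr0.
Qed.

(** * Classes of points *)

(* Such lists are read with [nth 1], so that index 4 is a homogenizing
   coordinate, constantly equal to 1. The order [s] of the coordinates is a
   parameter, which makes the search symmetric under coordinate permutations. *)
Definition coords (s : 'S_4) (p : pt4) : seq nat := [seq p (s i) | i <- enum 'I_4].
Definition cls s p := [seq minn 2 x | x <- coords s p].

Lemma size_cls s p : size (cls s p) = 4.
Proof. by rewrite size_map size_map size_enum_ord. Qed.

Lemma nth_coords s p (i : 'I_4) : nth 1 (coords s p) i = p (s i).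
Proof. by rewrite (nth_map i) ?size_enum_ord // nth_ord_enum. Qed.

Lemma nth_cls s p k : nth 1 (cls s p) k = minn 2 (nth 1 (coords s p) k).
Proof.
have [lt4|ge4] := ltnP k (size (coords s p)); first by rewrite (nth_map 1).
by rewrite !nth_default // size_map.
Qed.

(* [all], except that the tail is not evaluated by [vm_compute] after a failure. *)
Fixpoint every T (a : pred T) s :=
  if s is x :: s' then if a x then every a s' else false else true.

Lemma everyE T (a : pred T) s : every a s = all a s.
Proof. by elim: s => //= x s ->. Qed.

(* [F] lists classes: sums are exact up to 1, and an entry 2 means at least 2. *)
Definition colsum (F : seq (seq nat)) i := sumn [seq nth 1 c i | c <- F].
Definition dead F := every (fun i => 1 < colsum F i) (iota 0 4).
Definition pyramidal F := has (fun i => colsum F i == 1) (iota 0 4).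
(** An entry 2 of [c] stands for any larger value too, so the comparison is certain only where the
    entry of [c] is exact. *)
Definition below (c d : seq nat) :=
  all (fun i => (nth 1 c i <= nth 1 d i) && (nth 1 c i < 2)) (iota 0 4).

(** * Certifying affine independence from classes *)

(* [(h1, h2)] is the affine form summing the coordinates in [h1] minus those in
   [h2]. Its sign is certain on a class if no truncated entry is subtracted. *)
Definition form := (seq nat * seq nat)%type.
Definition half_val (h c : seq nat) := sumn [seq nth 1 c i | i <- h].
Definition opp_form (f : form) : form := (f.2, f.1).
Definition form_ge0 (f : form) c :=
  all (fun i => nth 1 c i < 2) f.2 && (half_val f.2 c <= half_val f.1 c).
Definition form_gt0 (f : form) c := form_ge0 f c && (half_val f.2 c < half_val f.1 c).
Definition keep (h : form -> form) (fs : seq (form * bool)) c :=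
  [seq (g.1, g.2 || form_gt0 (h g.1) c) | g <- fs & form_ge0 (h g.1) c].
(* Runs through the signs of the coefficients of a relation between points with
   classes [F]. So far [k] coefficients are nonzero, and [fs] are the forms whose
   weighted values are all nonnegative, flagged if one is positive. Distinct
   points admit no nontrivial relation with at most two nonzero coefficients. *)
Fixpoint separated k (fs : seq (form * bool)) (F : seq (seq nat)) : bool :=
  if F is c :: F' then
    if separated k.+1 (keep id fs c) F' then
      if separated k.+1 (keep opp_form fs c) F' then separated k fs F'
      else false
    else false
  else (k <= 2) || has snd fs.

Definition pairs n := [seq (i, j) | j <- iota 0 n, i <- iota 0 j].
(* [x_i], [x_i - x_j], [x_i - 1], [x_i + x_j - 1], the constant 1, and opposites:
   these were found to suffice for the search. *)
Definition forms : seq (form * bool) :=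
  let fs := [seq ([:: i], [::]) | i <- iota 0 5] ++
            [seq ([:: ij.1], [:: ij.2]) | ij <- pairs 5] ++
            [seq ([:: ij.1; ij.2], [:: 4]) | ij <- pairs 4] in
  [seq (f, false) | f <- fs ++ [seq opp_form f | f <- fs]].

Fixpoint picks T k (L : seq T) : seq (seq T * seq T) :=
  match k, L with
  | 0, _ => [:: ([::], L)]
  | _, [::] => [::]
  | k'.+1, x :: L' => [seq (x :: FR.1, FR.2) | FR <- picks k' L'] ++
                      [seq (FR.1, x :: FR.2) | FR <- picks k L']
  end.
(* The only point with a nonzero [i]-th coordinate has coefficient zero in every
   relation; removing such points first spares most sign patterns. *)
Definition isolated (FR : seq (seq nat) * seq (seq nat)) :=
  has (fun i => (0 < colsum FR.1 i) && (colsum FR.2 i == 0)) (iota 0 4).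
Fixpoint indep n (F : seq (seq nat)) :=
  if n is n'.+1 then
    if [seq FR.2 | FR <- picks 1 F & isolated FR] is R :: _ then indep n' R
    else separated 0 forms F
  else separated 0 forms F.
Definition bad F := if dead F then indep 4 F else false.
(** Four points suffice, as an independent subset of a hyperplane in dimension 4 has no more. [Ss]
    is formed before [d] is taken, so that a partial application computes it once. *)
Definition compatible L c :=
  let Ss := unzip1 (picks 0 L ++ picks 1 L ++ picks 2 L) in
  fun d => if below c d then false else if below d c then false else
     every (fun S => ~~ bad [:: c, d & S]) Ss.

(** * Soundness of the independence certificates *)

Lemma picksP (T1 T2 : eqType) (f : T1 -> T2) k ps FR : FR \in picks k (map f ps) ->
  exists qs rs, [/\ FR = (map f qs, map f rs), perm_eq (qs ++ rs) ps & size qs = k].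
Proof.
elim: ps k FR => [|p ps IH] [|k] FR //=; rewrite ?inE ?mem_cat.
- by move/eqP->; exists [::], [::].
- by move/eqP->; exists [::], (p :: ps).
case/orP=> /mapP[_ /IH[qs [rs [-> qrs sq]]] ->] /=.
  by exists (p :: qs), rs; rewrite /= perm_cons sq.
exists qs, (p :: rs); split=> //; rewrite -cat1s perm_catCA /=.
by rewrite perm_cons.
Qed.

(** If either sum is at most 1, no entry involved was truncated. *)
Lemma colsum_cls s ps (i : 'I_4) :
  colsum (map (cls s) ps) i <= 1 \/ sumn [seq p (s i) | p : pt4 <- ps] <= 1 ->
  colsum (map (cls s) ps) i = sumn [seq p (s i) | p : pt4 <- ps].
Proof.
rewrite /colsum; elim: ps => //= p ps IH; rewrite nth_cls nth_coords => H.
have {}IH := IH _; rewrite -IH; last by case: H => H; [left|right]; lia.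
case: H => H; first by lia.
suff: p (s i) <= 1 by lia.
by lia.
Qed.

(** The subtracted half is exact and truncation can only lower the added half, so a sign read on the
    class holds for the point. *)
Lemma form_ge0P f s (p : pt4) : form_ge0 f (cls s p) ->
  half_val f.2 (cls s p) = half_val f.2 (coords s p) /\
  half_val f.1 (cls s p) <= half_val f.1 (coords s p).
Proof.
case/andP=> /allP sm _; split; last first.
  by rewrite /half_val; elim: f.1 => //= i h IH; rewrite nth_cls; lia.
rewrite /half_val; congr sumn; apply/eq_in_map => i /sm.
by rewrite nth_cls; lia.
Qed.

Definition form_val s (f : form) (p : pt4) : rat :=
  ((half_val f.1 (coords s p))%:R - (half_val f.2 (coords s p))%:R)%R.

Lemma form_ge0_val s f p : form_ge0 f (cls s p) -> (0 <= form_val s f p)%R.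
Proof.
move=> f0; have [e l] := form_ge0P f0; case/andP: f0 => _ f0.
by rewrite subr_ge0 ler_nat -e (leq_trans f0).
Qed.

Lemma form_gt0_val s f p : form_gt0 f (cls s p) -> (0 < form_val s f p)%R.
Proof.
case/andP=> f0 f1; have [e l] := form_ge0P f0.
by rewrite subr_gt0 ltr_nat -e (leq_trans f1).
Qed.

Lemma form_val_opp s f p : (form_val s (opp_form f) p = - form_val s f p)%R.
Proof. by rewrite /form_val opprB. Qed.

(** [T f] stands for the weighted value of [f] over the points already processed, [k] of them with
    nonzero coefficient. At the end of the list it is 0, so no form is flagged and [k <= 2]. *)
Lemma separatedP s (lam : pt4 -> rat) ps k fs (T : form -> rat) :
  separated k fs (map (cls s) ps) ->
  (forall g, g \in fs -> if g.2 then 0 < T g.1 else 0 <= T g.1)%R ->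
  (forall f, T f + \sum_(p <- ps) lam p * form_val s f p = 0)%R ->
  k + count (fun p => lam p != 0%R) ps <= 2.
Proof.
elim: ps k fs T => [|p ps IH] k fs T /=.
  case/orP=> [|/hasP[[f []] // ffs _]] Tfs T0; first by rewrite addn0.
  by have := Tfs _ ffs; have := T0 f; rewrite big_nil addr0 /= => ->; rewrite ltxx.
case: ifP => // sepP; case: ifP => // sepN sep0 Tfs T0.
have step h : (forall f, 0 <= form_val s (h f) p -> 0 <= lam p * form_val s f p)%R ->
    (forall f, 0 < form_val s (h f) p -> 0 < lam p * form_val s f p)%R ->
    separated k.+1 (keep h fs (cls s p)) (map (cls s) ps) ->
    k.+1 + count (fun p => lam p != 0%R) ps <= 2.
  move=> h0 h1 /IH; apply=> [g|f]; last first.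
    by have := T0 f; rewrite big_cons addrA; apply.
  case/mapP=> g'; rewrite mem_filter => /andP[/form_ge0_val/h0 ge0 /Tfs Tg] -> /=.
  case: (g'.2) Tg => /= Tg; first by rewrite ltr_pwDl.
  case: ifP => [/form_gt0_val/h1 gt0|_]; first by rewrite ltr_wpDl.
  by rewrite addr_ge0.
have [lt0|gt0|eq0] := ltrgtP (lam p) 0%R.
- rewrite addnA addn1; apply: step sepN => f; rewrite form_val_opp ?oppr_ge0 ?oppr_gt0 => f0.
    by rewrite mulr_le0 // ltW.
  by rewrite nmulr_rgt0.
- rewrite addnA addn1; apply: step sepP => f f0; first by rewrite mulr_ge0 // ltW.
  by rewrite mulr_gt0.
- rewrite add0n; apply: IH sep0 Tfs _ => f.
  by have := T0 f; rewrite big_cons eq0 mul0r add0r.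
Qed.

Lemma sum_form_val s (lam : pt4 -> rat) ps f :
  (\sum_(p <- ps) lam p = 0)%R ->
  (forall j : 'I_4, \sum_(p <- ps) lam p * (p j)%:R = 0)%R ->
  (\sum_(p <- ps) lam p * form_val s f p = 0)%R.
Proof.
move=> l0 lj.
have coord0 k : (\sum_(p <- ps) lam p * (nth 1 (coords s p) k)%:R = 0)%R.
  have [lt4|ge4] := ltnP k 4.
    transitivity (\sum_(p <- ps) lam p * (p (s (Ordinal lt4)))%:R)%R => //.
    by apply: eq_bigr => p _; rewrite -(nth_coords s p (Ordinal lt4)).
  (* Beyond the four coordinates the default value 1 is read, which leaves the sum of the
     coefficients. *)
  apply: etrans l0; apply: eq_bigr => p _.
  by rewrite nth_default ?mulr1 // size_map size_enum_ord.
have half0 h : (\sum_(p <- ps) lam p * (half_val h (coords s p))%:R = 0)%R.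
  elim: h => [|k h IH]; first by rewrite big1 // => p _; rewrite mulr0.
  under eq_bigr do rewrite /half_val /= natrD mulrDr.
  by rewrite big_split /= coord0 IH addr0.
by under eq_bigr do rewrite mulrBr; rewrite sumrB !half0 subrr.
Qed.

(** A single nonzero coefficient contradicts the zero sum; two are opposite, and then the two points
    coincide. *)
Lemma short_relation (lam : pt4 -> rat) ps : uniq ps ->
  (\sum_(p <- ps) lam p = 0)%R ->
  (forall j : 'I_4, \sum_(p <- ps) lam p * (p j)%:R = 0)%R ->
  count (fun p => lam p != 0%R) ps <= 2 -> forall p, p \in ps -> (lam p = 0)%R.
Proof.
move=> ups; rewrite -size_filter; set qs := [seq p <- ps | _].
have restr (g : pt4 -> rat) : (\sum_(p <- ps) lam p * g p = \sum_(p <- qs) lam p * g p)%R.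
  rewrite big_filter [LHS](bigID (fun p => lam p != 0%R)) /= [X in (_ + X)%R]big1 ?addr0 //.
  by move=> p /negPn/eqP->; rewrite mul0r.
have uqs : uniq qs by rewrite filter_uniq.
have qs0 q : q \in qs -> (lam q != 0)%R by rewrite mem_filter => /andP[].
move=> l0 lj sq; suff qs_nil : qs = [::].
  move=> p pps; apply/eqP; apply: contraT => lp.
  by have: p \in qs; [rewrite mem_filter lp | rewrite qs_nil].
have {}l0 : (\sum_(p <- qs) lam p = 0)%R.
  rewrite -[RHS]l0; transitivity (\sum_(p <- qs) lam p * 1)%R.
    by apply: eq_bigr => p _; rewrite mulr1.
  by rewrite -restr; apply: eq_bigr => p _; rewrite mulr1.
have {}lj j : (\sum_(p <- qs) lam p * (p j)%:R = 0)%R by rewrite -restr lj.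
case: qs uqs qs0 sq l0 lj {restr} => [|p [|q []]] // uqs qs0 _.
  by rewrite big_seq1 => lp; have := qs0 p (mem_head _ _); rewrite lp eqxx.
rewrite big_cons big_seq1 => /eqP; rewrite addr_eq0 => /eqP lp lj.
move: uqs; rewrite /= inE andbT => /negP[]; apply/eqP/ffunP => j; apply/eqP.
rewrite -(eqr_nat rat) -subr_eq0.
have /eqP := lj j; rewrite big_cons big_seq1 lp mulNr addrC -mulrBr mulf_eq0.
rewrite (negPf (qs0 q _)) ?inE ?eqxx ?orbT //=.
by rewrite -opprB oppr_eq0.
Qed.

Lemma aff_free_perm l1 l2 : perm_eq l1 l2 -> aff_free l1 -> aff_free l2.
Proof.
move=> l12 fl lam l0 lj p; rewrite -(perm_mem l12); apply: fl; first by rewrite (perm_big _ l12).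
by move=> j; rewrite (perm_big _ l12).
Qed.

Lemma aff_free_cons (p : pt4) (l : seq pt4) (j : 'I_4) :
  p j != 0 -> (forall q, q \in l -> q j = 0) -> aff_free l -> aff_free (p :: l).
Proof.
move=> pj lj fl lam; rewrite big_cons => l0 ll0.
have lp : (lam p = 0)%R.
  have /eqP := ll0 j; rewrite big_cons big_seq big1 => [|q /lj->]; last by rewrite mulr0.
  by rewrite addr0 mulf_eq0 pnatr_eq0 (negPf pj) orbF => /eqP.
move=> q; rewrite inE => /predU1P[->//|]; apply: fl; first by move: l0; rewrite lp add0r.
by move=> k; have := ll0 k; rewrite big_cons lp mul0r add0r.
Qed.

Lemma leq_sumn x s : x \in s -> x <= sumn s.
Proof. by elim: s => //= y s IH; rewrite inE => /predU1P[->|/IH]; lia. Qed.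

Lemma indepP s n ps : uniq ps -> indep n (map (cls s) ps) -> aff_free ps.
Proof.
have sepP qs : uniq qs -> separated 0 forms (map (cls s) qs) -> aff_free qs.
  move=> uqs sep lam l0 lj; apply: short_relation => //; rewrite -[count _ _]add0n.
  apply: (separatedP (T := fun => 0%R) sep) => [g|f].
    by case/mapP=> f _ -> /=.
  by rewrite add0r sum_form_val.
elim: n ps => [|n IH] ps ups /=; first exact: sepP.
case E: [seq _ | _ <- _ & _] => [|R Rs]; first exact: sepP.
have: R \in R :: Rs by apply: mem_head.
rewrite -E => /mapP[FR]; rewrite mem_filter => /andP[hasFR].
case/hasP: hasFR => k; rewrite mem_iota => /= k4 H /picksP[qs [rs [eFR qrs sq]]] ->.
case: qs sq eFR qrs => [|q []] // _ eFR qrs.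
have := perm_uniq qrs; rewrite ups => /= /andP[_ urs].
rewrite eFR /= in H *; move=> /(IH _ urs) frs; apply: aff_free_perm qrs _.
case/andP: H => q0 /eqP rs0.
have rsE := @colsum_cls s rs (Ordinal k4) (or_introl _).
apply: (@aff_free_cons _ _ (s (Ordinal k4))) => // [|r rrs].
  move: q0; rewrite /colsum /= addn0 nth_cls (nth_coords s q (Ordinal k4)); lia.
apply/eqP; rewrite -leqn0.
apply: leq_trans (leq_sumn (map_f (fun p : pt4 => p (s (Ordinal k4))) rrs)) _.
by rewrite -rsE rs0.
Qed.

(** * The search *)

Definition cross := [:: [:: 1; 1; 0; 0]; [:: 1; 0; 1; 0]; [:: 1; 0; 0; 1];
        [:: 0; 1; 1; 0]; [:: 0; 1; 0; 1]; [:: 0; 0; 1; 1]].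
(* Each list contains the class of a further point of [tau], other than those
   with classes [L]: because [tau] is not a B1-facet, not a B2-facet, not a flat
   border, not the cross-polytope, and because triples extend to B-simplices. *)
Definition demands (L cands : seq (seq nat)) : seq (seq (seq nat)) :=
  [seq [seq d <- cands | 0 < nth 1 d i] | i <- iota 0 4 & colsum L i <= 1] ++
  [seq [seq d <- cands | 1 < nth 1 d ij.1 + nth 1 d ij.2] | ij <- pairs 4 &
    all (fun c => nth 1 c ij.1 + nth 1 c ij.2 <= 1) L] ++
  [seq [seq d <- cands | (0 < nth 1 d ij.1) && (0 < nth 1 d ij.2)] | ij <- pairs 4 &
    [&& 2 <= count (fun c => nth 1 c ij.1 + nth 1 c ij.2 == 0) L,
        count (fun c => (0 < nth 1 c ij.1) && (0 < nth 1 c ij.2)) L == 1 &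
        has (fun c => (nth 1 c ij.1 == 1) && (nth 1 c ij.2 == 1)) L]] ++
  (if perm_eq L cross then [:: [seq d <- cands | d \notin cross]] else [::]) ++
  [seq [seq d <- cands | pyramidal (d :: FR.1)] | FR <- picks 3 L &
     if every (fun c => ~~ pyramidal (c :: FR.1)) FR.2 then indep 4 FR.1 else false].

(** Every demand is a sound choice; the one with the fewest candidates branches least. *)
Fixpoint shortest T (b : seq T) (bs : seq (seq T)) :=
  if bs is b' :: bs' then shortest (if size b' < size b then b' else b) bs' else b.
(* A refuted class is no longer a candidate in the remaining branches. *)
Fixpoint refute_each (g : seq nat -> seq (seq nat) -> bool) cands bs :=
  if bs is c :: bs' then
    if g c cands then refute_each g [seq d <- cands | d != c] bs' else false
  else true.
(** [L] lists the classes of known points of [tau], and [cands] contains those of all other points.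
    Exhausting the depth [n] or finding no demand counts as failure. *)
Fixpoint refute n (L cands : seq (seq nat)) : bool :=
  if n is n'.+1 then
    if demands L cands is b :: bs then
      refute_each (fun c cands' => refute n' (c :: L) (filter (compatible L c) cands'))
         cands (shortest b bs)
    else false
  else false.
(* A class is refuted for all orders of the coordinates at once, hence with its
   whole orbit. *)
Fixpoint refute_orbits n cands :=
  if ohead cands is Some c then
    if n is n'.+1 then
      if refute 8 [:: c] (filter (compatible [::] c) cands) then
        refute_orbits n' [seq d <- cands | ~~ perm_eq c d] else false
    else false
  else true.
Fixpoint words n :=
  if n is n'.+1 then [seq x :: w | x <- [:: 2; 1; 0], w <- words n'] else [:: [::]].
(* The order only affects the size of the search. *)
Definition point_classes :=
  sort (fun c d => sumn d <= sumn c) [seq c <- words 4 | ~~ bad [:: c]].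

Definition exceptional (tau : {fset pt4}) :=
  [/\ B_facet tau, ~ B1_facet tau, ~ B2_facet tau, ~ flat_border tau &
      tau <> cross_polytope].

(** * Soundness of the exclusions and of the demands *)

Lemma permS_ord (s : 'S_4) (j : 'I_4) : exists i : 'I_4, j = s i.
Proof. by exists ((s^-1)%g j); rewrite permKV. Qed.

(** An independent list extends to a B-simplex with some coordinate sum 1, but a dead list already
    exceeds 1 in every coordinate. *)
Lemma badP (tau : {fset pt4}) s ps : B_facet tau -> uniq ps -> {subset ps <= tau} ->
  ~~ bad (map (cls s) ps).
Proof.
move=> Bt ups pst; apply/negP; rewrite /bad; case: ifP => // dps /(indepP ups).
case/(B_facet_extension Bt ups pst) => m [j [_ _ _ sum1]].
have [i ji] := permS_ord s j; move: dps; rewrite /dead everyE => /allP/(_ i).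
rewrite mem_iota ltn_ord => /(_ isT); apply/negP; rewrite -leqNgt.
have le1 : sumn [seq p (s i) | p : pt4 <- ps] <= 1.
  by rewrite -ji; move: sum1; rewrite map_cat sumn_cat; lia.
by rewrite colsum_cls //; right.
Qed.

Lemma belowP (tau : {fset pt4}) s p q : B_facet tau -> p \in tau -> q \in tau ->
  below (cls s p) (cls s q) -> p = q.
Proof.
move=> Bt pt qt /allP pq; apply: (B_facet_antichain Bt) => // j.
have [i ->] := permS_ord s j; have := pq i.
rewrite mem_iota ltn_ord => /(_ isT); rewrite !nth_cls !nth_coords.
by move: (p _) (q _) => x y; lia.
Qed.

Lemma compatibleP (tau : {fset pt4}) s ps p q : B_facet tau ->
  uniq (q :: p :: ps) -> {subset q :: p :: ps <= tau} ->
  compatible (map (cls s) ps) (cls s p) (cls s q).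
Proof.
move=> Bt uq qt; rewrite /compatible.
have pt : p \in tau by apply: qt; rewrite !inE eqxx orbT.
have q_t : q \in tau by apply: qt; rewrite !inE eqxx.
have qp : q != p by move: uq; rewrite /= inE negb_or => /andP[/andP[]].
case: ifP => [/(belowP Bt pt q_t) e|_]; first by rewrite e eqxx in qp.
case: ifP => [/(belowP Bt q_t pt) e|_]; first by rewrite e eqxx in qp.
rewrite everyE; apply/allP => F.
have key k : F \in unzip1 (picks k (map (cls s) ps)) -> ~~ bad [:: cls s p, cls s q & F].
  case/mapP => FR /picksP[qs [rs [-> qrs _]]] ->.
  rewrite (_ : [:: _, _ & _] = map (cls s) [:: p, q & qs]) //; apply: (badP s Bt).
    move: uq; rewrite /= !inE !negb_or -(perm_uniq qrs) cat_uniq.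
    rewrite -!(perm_mem qrs) !mem_cat !negb_or eq_sym.
    by case/and3P=> /and3P[-> -> _] /andP[-> _] /andP[-> _].
  move=> r; rewrite !inE => rq; apply: qt; rewrite !inE -(perm_mem qrs) mem_cat.
  by case/or3P: rq => ->; rewrite ?orbT.
by rewrite /unzip1 !map_cat !mem_cat => /or3P[] /key.
Qed.

Lemma new_point (tau : {fset pt4}) (ps : seq pt4) (f : pred pt4) :
  ~ (forall q, q \in tau -> q \notin ps -> ~~ f q) ->
  exists q, [/\ q \in tau, q \notin ps & f q].
Proof.
have [/hasP[q qt /andP[]]|/hasPn N] := boolP (has (fun q => (q \notin ps) && f q) tau).
  by exists q.
by case=> q /N; rewrite negb_and => /orP[/negP|].
Qed.

Lemma sumn_tau_gt1 (tau : {fset pt4}) (i : 'I_4) : B_facet tau -> ~ B1_facet tau ->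
  1 < sumn [seq p i | p : pt4 <- tau].
Proof.
move=> /(B_facet_coord_neq0 i)[p pt p0] nB1; rewrite ltnNge; apply/negP => le1.
have rem1 := perm_sumn (perm_map (fun p : pt4 => p i) (perm_to_rem pt)).
have p1 : p i = 1 by move: le1 p0; rewrite rem1 /=; move: (p i) (sumn _) => x y; lia.
have q0 q : q \in tau -> q != p -> q i = 0.
  move=> qt qp; have : q \in rem p tau by rewrite mem_rem_uniq ?fset_uniq // inE qp.
  by move/(map_f (fun p : pt4 => p i))/leq_sumn; move: le1; rewrite rem1 /= p1; move: (q i) (sumn _) => x y; lia.
apply: nB1; exists i; split=> [|q qt].
  rewrite (_ : [fset q in tau | _] = [fset p]) ?cardfs1 //; apply/fsetP => q.
  rewrite !inE; have [->|qp] := eqVneq q p; first by rewrite pt p0.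
  by apply/negP => /andP[/q0 ->].
by have [->|qp] := eqVneq q p; rewrite ?p1 // q0.
Qed.

Lemma mem_pairs n ij : ij \in pairs n -> ij.1 < ij.2 < n.
Proof.
by case/allpairsPdep => j [i [jn ij_ ->]] /=; rewrite !mem_iota in jn ij_; lia.
Qed.

Lemma mem_cross c : size c = 4 -> (c \in cross) = all (geq 1) c && (sumn c == 2).
Proof.
case: c => [|x [|y [|z [|t []]]]] // _.
by case: x => [|[|x]]; case: y => [|[|y]]; case: z => [|[|z]]; case: t => [|[|t]].
Qed.

(** Membership in [cross] means entries at most 1 with sum 2, which neither permuting nor truncating
    the coordinates affects. *)
Lemma mem_cross_polytope p s : (p \in cross_polytope) = (cls s p \in cross).
Proof.
have mkptE a b c d : (p == mkpt a b c d) = (coords 1 p == [:: a; b; c; d]).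
  apply/eqP/eqP => [->|E].
    apply: (@eq_from_nth _ 1) => [|k]; rewrite size_map size_enum_ord // => k4.
    by rewrite (nth_coords _ _ (Ordinal k4)) perm1 ffunE; apply: set_nth_default.
  apply/ffunP => i; have := nth_coords 1 p i; rewrite E perm1 ffunE => <-.
  exact: set_nth_default.
transitivity (coords 1 p \in cross); first by rewrite !inE !mkptE -!orbA.
have sz s' : size (coords s' p) = 4 by rewrite size_map size_enum_ord.
have pc : perm_eq (coords 1 p) (coords s p).
  rewrite /coords (map_comp p) (map_comp p s); apply: perm_map; apply: uniq_perm.
  - by rewrite map_inj_uniq ?enum_uniq //; apply: perm_inj.
  - by rewrite map_inj_uniq ?enum_uniq //; apply: perm_inj.
  - move=> i; have mem_s (s' : 'S_4) : i \in map s' (enum 'I_4).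
      by rewrite -(permKV s' i) map_f ?mem_enum.
    by rewrite !mem_s.
rewrite !mem_cross ?size_cls ?sz // (perm_all _ pc) (perm_sumn pc).
have -> : all (geq 1) (cls s p) = all (geq 1) (coords s p).
  by rewrite all_map; apply: eq_all => x /=; lia.
have [/allP le1|] := boolP (all _ _); rewrite //= /cls.
by congr (sumn _ == 2); apply/esym/map_id_in => x /le1 /=; lia.
Qed.

Lemma B1_demand (tau : {fset pt4}) s ps (i : 'I_4) : exceptional tau ->
  uniq ps -> {subset ps <= tau} -> colsum (map (cls s) ps) i <= 1 ->
  exists q, [/\ q \in tau, q \notin ps & 0 < nth 1 (cls s q) i].
Proof.
move=> [Bt nB1 _ _ _] ups pst le1; apply: new_point => q0.
have := sumn_tau_gt1 (s i) Bt nB1.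
have tau_ps : perm_eq tau (ps ++ [seq q : pt4 <- tau | q \notin ps]).
  apply: uniq_perm; rewrite ?cat_uniq ?ups ?filter_uniq ?fset_uniq // ?andbT.
    by apply/hasPn => q; rewrite mem_filter => /andP[].
  move=> q; rewrite mem_cat mem_filter.
  by case: (boolP (q \in ps)) => //= /pst.
rewrite (perm_sumn (perm_map _ tau_ps)) map_cat sumn_cat -colsum_cls; last by left.
have -> : sumn [seq p (s i) | p : pt4 <- [seq q : pt4 <- tau | q \notin ps]] = 0.
  apply/eqP/natnseq0P/all_pred1P/allP => x /mapP[q].
  rewrite mem_filter => /andP[qps qt] ->; have := q0 q qt qps.
  by rewrite nth_cls nth_coords /=; move: (q _) => y; lia.
by move: le1; lia.
Qed.

Lemma B2_demand (tau : {fset pt4}) s ps (i j : 'I_4) : exceptional tau -> i < j ->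
  all (fun c => nth 1 c i + nth 1 c j <= 1) (map (cls s) ps) ->
  exists q, [/\ q \in tau, q \notin ps & 1 < nth 1 (cls s q) i + nth 1 (cls s q) j].
Proof.
move=> [_ _ nB2 _ _] ij; rewrite all_map => /allP psle; apply: new_point => taule.
apply: nB2; exists (s i), (s j); rewrite (inj_eq perm_inj) neq_ltn ij; split=> // q qt.
have: nth 1 (cls s q) i + nth 1 (cls s q) j <= 1.
  by have [/psle //|/(taule q qt)] := boolP (q \in ps); rewrite -leqNgt.
rewrite !nth_cls !nth_coords; move: (q (s i)) (q (s j)).
by case=> [|[|x]] [|[|y]] //; lia.
Qed.

(** The points [A], [B], [C] of a flat border are already among [ps]; only a further point with both
    coordinates positive can prevent one. *)
Lemma flat_demand (tau : {fset pt4}) s ps (i j : 'I_4) : exceptional tau -> i < j ->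
  uniq ps -> {subset ps <= tau} ->
  2 <= count (fun c => nth 1 c i + nth 1 c j == 0) (map (cls s) ps) ->
  count (fun c => (0 < nth 1 c i) && (0 < nth 1 c j)) (map (cls s) ps) = 1 ->
  has (fun c => (nth 1 c i == 1) && (nth 1 c j == 1)) (map (cls s) ps) ->
  exists q, [/\ q \in tau, q \notin ps &
     (0 < nth 1 (cls s q) i) && (0 < nth 1 (cls s q) j)].
Proof.
move=> [_ _ _ nfl _] ij ups pst; rewrite !count_map has_map -!size_filter.
set zs := filter _ _ => z2; set cs := filter _ _ => c1 /hasP[C Cps /= C1].
apply: new_point => tau0; apply: nfl; exists (s i), (s j), C.
move: C1; rewrite !nth_cls !nth_coords => C1.
have Ccs : C \in cs.
  rewrite mem_filter Cps /= !nth_cls !nth_coords.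
  by move: C1; move: (C (s i)) (C (s j)) => x y; lia.
have csC : cs = [:: C].
  by case: cs c1 Ccs => [|x []] // _; rewrite inE => /eqP ->.
have uzs : uniq zs by rewrite filter_uniq.
have zs0 A : A \in zs -> [/\ A \in tau, A (s i) = 0 & A (s j) = 0].
  rewrite mem_filter /= !nth_cls !nth_coords => /andP[A0 /pst ->].
  by move: A0; move: (A (s i)) (A (s j)) => x y; split=> //; lia.
split.
  rewrite (inj_eq perm_inj) neq_ltn ij pst //; split=> //.
    by move: C1; move: (C (s i)) (C (s j)) => x y; lia.
  by move: C1; move: (C (s i)) (C (s j)) => x y; lia.
split.
  case: zs z2 uzs zs0 => [|A [|B zs]] // _ /= /andP[] /[!inE] /norP[AB _] _ zs0.
  have [At Ai Aj] := zs0 A (mem_head _ _).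
  have [Bt Bi Bj] : [/\ B \in tau, B (s i) = 0 & B (s j) = 0].
    by apply: zs0; rewrite !inE eqxx orbT.
  by exists A, B.
move=> x xt xC; have: ~~ ((0 < nth 1 (cls s x) i) && (0 < nth 1 (cls s x) j)).
  have [xps|/(tau0 x xt)//] := boolP (x \in ps).
  apply: contra xC => x0; have: x \in cs by rewrite mem_filter xps andbT.
  by rewrite csC inE.
rewrite !nth_cls !nth_coords; move: (x (s i)) (x (s j)) => y z.
by case: y => [|y]; [left|case: z => [|z]; [right|]]; lia.
Qed.

(** [ps] realizes all six classes, and a class without entry 2 determines its point; if all further
    classes were in [cross], [tau] would be the cross-polytope. *)
Lemma cross_demand (tau : {fset pt4}) s ps : exceptional tau ->
  {subset ps <= tau} -> perm_eq (map (cls s) ps) cross ->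
  exists q, [/\ q \in tau, q \notin ps & cls s q \notin cross].
Proof.
move=> [_ _ _ _ ncr] pst pcr; apply: new_point => taucr; apply: ncr.
apply/fsetP => q; apply/idP/idP => [qt|].
  rewrite (mem_cross_polytope q s).
  have [qps|/(taucr q qt)/negPn //] := boolP (q \in ps).
  by rewrite -(perm_mem pcr) map_f.
rewrite (mem_cross_polytope q s) => qcr; have := qcr.
rewrite -(perm_mem pcr) => /mapP[p pps qp]; suff -> : q = p by apply: pst.
apply/ffunP => j; have [i ->] := permS_ord s j.
have := congr1 (fun c => nth 1 c i) qp; rewrite /= !nth_cls !nth_coords.
move: qcr; rewrite mem_cross ?size_cls // => /andP[/allP/(_ (nth 1 (cls s q) i))].
rewrite mem_nth ?size_cls // nth_cls nth_coords => /(_ isT) /= + _.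
by move: (q _) (p _) => x y; lia.
Qed.

(** Three independent points extend to a B-simplex by a single point, which is not in [rs] because
    no class there makes the list pyramidal. *)
Lemma pyramid_demand (tau : {fset pt4}) s ps qs rs : exceptional tau ->
  uniq ps -> {subset ps <= tau} -> perm_eq (qs ++ rs) ps -> size qs = 3 ->
  indep 4 (map (cls s) qs) ->
  every (fun c => ~~ pyramidal (c :: map (cls s) qs)) (map (cls s) rs) ->
  exists q, [/\ q \in tau, q \notin ps & pyramidal (cls s q :: map (cls s) qs)].
Proof.
move=> [Bt _ _ _ _] ups pst qrs sq ind; rewrite everyE => /allP nrs.
have /and3P[uqs _ _] : [&& uniq qs, ~~ has (mem qs) rs & uniq rs].
  by rewrite -cat_uniq (perm_uniq qrs).
have qst : {subset qs <= tau}.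
  by move=> q qqs; apply: pst; rewrite -(perm_mem qrs) mem_cat qqs.
have [m [j [mt umq smq sum1]]] := B_facet_extension Bt uqs qst (indepP uqs ind).
have sm : size m = 1 by move: smq; rewrite size_cat sq; lia.
case: m sm mt umq {smq} sum1 => [|r []] // _ rt /= /andP[rqs _].
have [i ->] := permS_ord s j => sum1.
have pyr : pyramidal (cls s r :: map (cls s) qs).
  apply/hasP; exists (i : nat); first by rewrite mem_iota ltn_ord.
  by have /= -> := @colsum_cls s (r :: qs) i (or_intror _); rewrite /= sum1.
exists r; split=> //; first by apply: rt; rewrite inE.
rewrite -(perm_mem qrs) mem_cat negb_or rqs; apply: contraL pyr => rrs.
by apply: nrs; apply: map_f.
Qed.

Lemma demandsP (tau : {fset pt4}) s ps cands D : exceptional tau ->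
  uniq ps -> {subset ps <= tau} ->
  (forall q, q \in tau -> q \notin ps -> cls s q \in cands) ->
  D \in demands (map (cls s) ps) cands ->
  exists q, [/\ q \in tau, q \notin ps & cls s q \in D].
Proof.
move=> ex ups pst candsP.
have filterP (f : pred (seq nat)) : (exists q, [/\ q \in tau, q \notin ps & f (cls s q)]) ->
    exists q, [/\ q \in tau, q \notin ps & cls s q \in [seq d <- cands | f d]].
  by case=> q [qt qps fq]; exists q; rewrite mem_filter fq candsP.
rewrite /demands !mem_cat => /or4P[|||].
- case/mapP => i; rewrite mem_filter mem_iota => /andP[le1 i4] ->.
  by apply/filterP/(@B1_demand _ _ _ (Ordinal i4)).
- case/mapP => -[i j]; rewrite mem_filter => /andP[le1 /mem_pairs /= /andP[ij j4]] ->.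
  by apply/filterP/(@B2_demand _ _ _ (Ordinal (ltn_trans ij j4)) (Ordinal j4)).
- case/mapP => -[i j]; rewrite mem_filter => /andP[/and3P[z2 /eqP c1 C1]].
  move=> /mem_pairs /= /andP[ij j4] ->.
  by apply/filterP/(@flat_demand _ _ _ (Ordinal (ltn_trans ij j4)) (Ordinal j4)).
case/orP=> [|/mapP[FR]].
  by case: ifP => // pcr /[1!inE] /eqP->; apply/filterP/cross_demand.
rewrite mem_filter; case: ifP => //= + /andP[ind /picksP[qs [rs [eFR qrs sq]]]] ->.
rewrite eFR in ind * => /= ev; apply: (filterP (fun d => pyramidal (d :: map (cls s) qs))).
exact: pyramid_demand qrs sq ind ev.
Qed.

(** * Soundness of the branching *)

Lemma shortest_mem (T : eqType) (b : seq T) bs : shortest b bs \in b :: bs.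
Proof.
elim: bs b => [|b' bs IH] b; first exact: mem_head.
by have := IH (if size b' < size b then b' else b); rewrite /= !inE; case: ifP => _ /orP[->|->];
  rewrite ?orbT.
Qed.

(** Invariant: the candidates include the classes of all points of [tau] outside [ps]. Dropping a
    refuted class preserves it, since no such point has that class. *)
Lemma refute_eachP (tau : {fset pt4}) s (ps : seq pt4)
    (g : seq nat -> seq (seq nat) -> bool) cands bs :
  (forall q cands', q \in tau -> q \notin ps ->
     (forall r, r \in tau -> r \notin ps -> cls s r \in cands') ->
     g (cls s q) cands' -> False) ->
  (forall r, r \in tau -> r \notin ps -> cls s r \in cands) ->
  refute_each g cands bs ->
  forall q, q \in tau -> q \notin ps -> cls s q \notin bs.
Proof.
move=> gP; elim: bs cands => //= c bs IH cands candsP.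
case: ifP => // gc; have qc q : q \in tau -> q \notin ps -> cls s q != c.
  by move=> qt qps; apply/eqP => qc; apply: (gP q cands) => //; rewrite qc.
move=> /IH H q qt qps; rewrite inE negb_or qc // H // => r rt rps.
by rewrite mem_filter qc ?candsP.
Qed.

Lemma refuteP (tau : {fset pt4}) s n ps cands : exceptional tau ->
  uniq ps -> {subset ps <= tau} ->
  (forall q, q \in tau -> q \notin ps -> cls s q \in cands) ->
  ~~ refute n (map (cls s) ps) cands.
Proof.
move=> ex; elim: n ps cands => // n IH ps cands ups pst candsP /=.
case E: (demands _ _) => [|b bs] //; apply/negP => /refute_eachP H.
(* The chosen demand contains the class of a new point, while [H] excludes every class in it. *)
have := shortest_mem b bs; rewrite -E => /(demandsP ex ups pst candsP)[q [qt qps]].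
apply/negP; apply: H candsP q qt qps => q cands' qt qps cands'P; apply/negP.
have uq : uniq (q :: ps) by rewrite /= qps.
have qst : {subset q :: ps <= tau} by move=> r; rewrite inE => /predU1P[->|/pst].
apply: (IH (q :: ps)) => // r rt; rewrite inE negb_or => /andP[rq rps].
rewrite mem_filter cands'P // andbT; have [Bt _ _ _ _] := ex.
apply: (compatibleP s Bt); first by rewrite /= inE negb_or rq rps qps.
by move=> x; rewrite inE => /predU1P[->|/qst].
Qed.

Lemma refute_orbitsP (tau : {fset pt4}) n cands : exceptional tau ->
  (forall s p, p \in tau -> cls s p \in cands) -> ~~ refute_orbits n cands.
Proof.
move=> ex; have [p0 p0t _] : exists2 p, p \in tau & p ord0 != 0.
  by apply: B_facet_coord_neq0; case: ex.
elim: n cands => [|n IH] cands candsP /=;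
  have [c ->] : exists c, ohead cands = Some c
    by case: (cands) (candsP 1%g _ p0t) => // c; exists c.
  by [].
case: ifP => // ref; apply: IH => s p pt; rewrite mem_filter candsP // andbT.
apply/negP => cp; have sc : size c = 4 by rewrite (perm_size cp) size_cls.
(* Here [c] is the class of [p] in another coordinate order; as [cands] contains the classes for
   every order, the refutation of [c] applies to [p]. *)
have /tuple_permP[u cE] : perm_eq c (Tuple (introT eqP (size_cls s p))) := cp.
have {cE} cE : c = cls (u * s)%g p.
  apply: (@eq_from_nth _ 1) => [|k]; rewrite sc ?size_cls // cE => k4.
  rewrite nth_cls (nth_coords _ p (Ordinal k4)) permM.
  rewrite (nth_map (Ordinal k4)) ?size_enum_ord //.
  rewrite (_ : nth _ _ k = Ordinal k4); last by apply: val_inj; rewrite /= nth_enum_ord.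
  by rewrite (tnth_nth 1) /= nth_cls nth_coords.
move: ref; apply/negP; rewrite cE; apply: (@refuteP tau (u * s)%g 8 [:: p]) => //.
  by move=> q; rewrite inE => /eqP->.
move=> q qt; rewrite inE => qp; rewrite mem_filter -cE candsP // andbT cE.
have [Bt _ _ _ _] := ex; apply: (@compatibleP tau _ [::]) => //.
  by rewrite /= inE qp.
by move=> r; rewrite !inE => /orP[] /eqP ->.
Qed.

Lemma mem_words w : all (geq 2) w -> w \in words (size w).
Proof.
elim: w => //= x w IH /andP[x2 /IH w_]; rewrite !mem_cat.
by case: x x2 => [|[|[|]]] // _; rewrite (map_f _ w_) ?orbT.
Qed.

Lemma mem_point_classes (tau : {fset pt4}) s p : B_facet tau -> p \in tau ->
  cls s p \in point_classes.
Proof.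
move=> Bt pt; rewrite mem_sort mem_filter (badP s Bt (ps := [:: p])) // ?andTb; last first.
  by move=> q; rewrite inE => /eqP->.
rewrite -(size_cls s p) mem_words //; apply/allP => _ /mapP[x _ ->].
exact: geq_minl.
Qed.

(* 14 orbits: the multisets of size 4 over {0, 1, 2}, except 2222, which is dead. *)
Lemma refute_point_classes : refute_orbits 14 point_classes.
Proof. by vm_cast_no_check (erefl true). Qed.

Theorem mainTheorem1 (tau : {fset pt4}) :
  B_facet tau ->
  B1_facet tau \/ B2_facet tau \/ flat_border tau \/ tau = cross_polytope.
Proof.
move=> Bt; apply: NNPP => N.
have ex : exceptional tau by split=> // T; apply: N; tauto.
by have := refute_orbitsP 14 ex (fun s p => @mem_point_classes tau s p Bt); rewrite refute_point_classes.
Qed.
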